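(* Let $m\ge 2$ and let $p_j=(x_j,y_j)^T\in\mathbb{R}^2$, $j=1,\ldots,m$, be points such that $x_j\neq x_k$ for all $j\neq k$. A linear function $y(x)=ax+b$ ($a,b\in\mathbb{R}$) has minimal algebraic $L^1$-distance to the set $\{p_1,\ldots,p_m\}$ if and only if $(a,b)$ is contained in the convex hull of $E$.
   Context: Let $f:\mathbb{R}^2\to\mathbb{R}$, $f(a,b)=\sum_{j=1}^m|y_j-(ax_j+b)|$. The function $y(x)=ax+b$ has minimal algebraic $L^1$-distance to $\{p_1,\ldots,p_m\}$ if $f$ attains its global minimum over $\mathbb{R}^2$ at $(a,b)$. For $j\neq k$ set $a_{jk}=\frac{y_j-y_k}{x_j-x_k}$ and $b_{jk}=\frac{y_kx_j-y_jx_k}{x_j-x_k}$, so that $y=a_{jk}x+b_{jk}$ is the line through $p_j$ and $p_k$. Define $$E=\{(a_{jk},b_{jk}) : j>k \text{ and } f(a_{jk},b_{jk})=\min\{f(a,b):(a,b)\in\mathbb{R}^2\}\}\subset\mathbb{R}^2.$$ The convex hull of a set is the smallest convex set containing it. *)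

(* Defs.v *)
From mathcomp Require Import all_boot all_order all_algebra.
From mathcomp Require Import boolp classical_sets reals convex.

Set Implicit Arguments.
Unset Strict Implicit.
Unset Printing Implicit Defensive.

Import Order.TTheory GRing.Theory Num.Theory.
Local Open Scope classical_set_scope.
Local Open Scope ring_scope.

Definition convex_hull (R : numDomainType) (M : lmodType R) (A : set M) :
  set M := smallest (@convex_set R M) A.

(* The factors are written R^o so that the plane carries the product lmodType
   structure over R; R^o is convertible to R. *)
Definition plane (R : realType) : lmodType R := (R^o * R^o)%type.

Section AlgebraicL1Distance.
Context {R : realType} {m : nat}.
Variable p : 'I_m -> R * R.

Local Notation x j := (p j).1.
Local Notation y j := (p j).2.

Definition L1_dist (ab : plane R) : R :=
  \sum_(j < m) `|y j - (ab.1 * x j + ab.2)|.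

Definition minimal_L1_dist (ab : plane R) : Prop :=
  forall ab' : plane R, L1_dist ab <= L1_dist ab'.

Definition slope (j k : 'I_m) : R := (y j - y k) / (x j - x k).

Definition intercept (j k : 'I_m) : R :=
  (y k * x j - y j * x k) / (x j - x k).

Definition minimal_lines : set (plane R) :=
  [set ab | exists j k : 'I_m, [/\ (k < j)%N,
     ab = (slope j k, intercept j k) & minimal_L1_dist ab]].

End AlgebraicL1Distance.

(* Main.v *)
Require Import Defs.
From mathcomp Require Import all_boot all_order all_algebra.
From mathcomp Require Import boolp classical_sets reals convex.
From mathcomp Require Import interval_inference.
From mathcomp Require Import ring lra.

Set Implicit Arguments.
Unset Strict Implicit.
Unset Printing Implicit Defensive.

Local Open Scope classical_set_scope.
Local Open Scope ring_scope.

(** The set of minimizers of the convex function [L1_dist p] is convex, so it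
    contains the convex hull of [minimal_lines p].

    For the converse, consider a minimizer that does not yet pass through two
    of the points.  Move it in the plane of pairs (slope, intercept) along a
    direction that keeps the line through the point it meets, if there is one,
    and changes its value at every other abscissa: a vertical translation if it
    meets no point, a rotation about the point it meets otherwise.  Along this
    direction the distance is a weighted sum of the absolute values
    [`|t i - s|], where the parameter [t i] is the one at which the moving line
    reaches the point [i].  Such a sum is affine between two consecutive
    [t i]'s; as it is minimal at the interior point [0], it is constant up to
    the nearest [t i] on each side ([weighted_median_neighbours]).  Hence the
    line is a convex combination of two minimizers each of which meets one
    point more ([minimizer_between]).  Doing this at most twice leads to
    minimizers through two points, which are the elements of
    [minimal_lines p]. *)

Import Order.TTheory GRing.Theory Num.Theory.

(** * Minima of weighted sums of distances on the real line *)

Section WeightedMedian.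
Context {F : realFieldType} {I : finType}.
Implicit Types w t : I -> F.

Definition weighted_dist w t (s : F) : F := \sum_i w i * `|t i - s|.

(** If all the points of nonzero weight were negative, moving from [0] to the
    largest of them would bring each of them closer. *)
Lemma weighted_median_has_pos w t :
  (forall i, 0 <= w i) -> (forall i, w i != 0 -> t i != 0) ->
  (exists i, w i != 0) ->
  (forall s, weighted_dist w t 0 <= weighted_dist w t s) ->
  exists i, w i != 0 /\ 0 < t i.
Proof.
move=> w0 wt [i0 wi0] tmin.
have [[i /andP[wi ti]]|npos] :=
  pselect (exists i, (w i != 0) && (0 < t i)); first by exists i.
have tneg i : w i != 0 -> t i < 0.
  move=> wi; rewrite lt_neqAle wt//= leNgt; apply/negP => ti.
  by apply: npos; exists i; rewrite wi.
have [k wk kmax] := @arg_maxP _ F _ i0 (fun i => w i != 0) t wi0.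
have := tmin (t k); rewrite leNgt => /negP[].
rewrite /weighted_dist (bigD1 k)//= [ltRHS](bigD1 k)//=.
apply: ltr_leD.
  rewrite subrr normr0 mulr0 mulr_gt0 ?normr_gt0 ?subr0 ?wt//.
  by rewrite lt_neqAle eq_sym wk w0.
apply: ler_sum => i _; have [->|wi] := eqVneq (w i) 0; first by rewrite !mul0r.
apply: ler_wpM2l => //; rewrite subr0.
have tik : t i <= t k := kmax i wi.
by have tk := tneg k wk; rewrite !ler0_norm; lra.
Qed.

Lemma weighted_dist_opp w t s :
  weighted_dist w (fun i => - t i) s = weighted_dist w t (- s).
Proof. by apply: eq_bigr => i _; rewrite -normrN opprD !opprK. Qed.

(** Let [t j] and [t i] be the points of nonzero weight nearest to [0] on the
    two sides.  Every weighted term is affine in [s] between them.  So the value at [0] is a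
    proper average of the values at [t j] and [t i], neither of which is
    smaller; all three must agree. *)
Lemma weighted_median_neighbours w t :
  (forall i, 0 <= w i) -> (forall i, w i != 0 -> t i != 0) ->
  (exists i, w i != 0) ->
  (forall s, weighted_dist w t 0 <= weighted_dist w t s) ->
  exists j i, [/\ w j != 0 /\ w i != 0, t j < 0 < t i,
    weighted_dist w t (t j) = weighted_dist w t 0 &
    weighted_dist w t (t i) = weighted_dist w t 0].
Proof.
move=> w0 wt wex tmin.
have [i1 [wi1 ti1]] := weighted_median_has_pos w0 wt wex tmin.
have [j1 [wj1 tj1]] : exists i, w i != 0 /\ 0 < - t i.
  apply: (weighted_median_has_pos w0) => [i wi|//|s]; first by rewrite oppr_eq0 wt.
  by rewrite !weighted_dist_opp oppr0.
have Pi1 : (w i1 != 0) && (0 < t i1) by rewrite wi1.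
have Pj1 : (w j1 != 0) && (t j1 < 0) by rewrite wj1 -oppr_gt0.
have [i /andP[wi ti] imin] :=
  @arg_minP _ F _ i1 (fun i => (w i != 0) && (0 < t i)) t Pi1.
have [j /andP[wj tj] jmax] :=
  @arg_maxP _ F _ j1 (fun i => (w i != 0) && (t i < 0)) t Pj1.
have avg : (t i - t j) * weighted_dist w t 0 =
    t i * weighted_dist w t (t j) - t j * weighted_dist w t (t i).
  rewrite /weighted_dist !mulr_sumr -sumrB; apply: eq_bigr => k _.
  have [->|wk] := eqVneq (w k) 0; first by rewrite !mul0r !mulr0 subrr.
  rewrite subr0; case: (ltgtP (t k) 0) => [tk|tk|tk]; last first.
  - by move: (wt k wk); rewrite tk eqxx.
  - have tik : t i <= t k by apply: imin; rewrite wk.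
    by rewrite !ger0_norm; [ring|lra..].
  - have tkj : t k <= t j by apply: jmax; rewrite wk.
    by rewrite !ler0_norm; [ring|lra..].
exists j, i; have gj := tmin (t j); have gi := tmin (t i).
by split; rewrite ?tj ?ti//; apply/eqP; rewrite eq_le; apply/andP; split=> //; nra.
Qed.

End WeightedMedian.

(** * Minimizers of the distance *)

Section Minimizers.
Context {R : realType} {m : nat}.
Variable p : 'I_m -> R * R.
Local Notation x j := (p j).1.
Local Notation y j := (p j).2.

Definition residual (v : plane R) (j : 'I_m) : R := y j - (v.1 * x j + v.2).

Definition change (d : plane R) (j : 'I_m) : R := d.1 * x j + d.2.

Lemma residual_line (v d : plane R) (s : R) j :
  residual (v.1 + s * d.1, v.2 + s * d.2) j = residual v j - s * change d j.
Proof. by rewrite /residual /change /=; ring. Qed.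

Lemma conv_planeE (l : {i01 R}) (u v : plane R) :
  conv l (u : convex_lmodType (plane R)) v =
    (l%:num * u.1 + (1 - l%:num) * v.1,
     l%:num * u.2 + (1 - l%:num) * v.2).
Proof. by []. Qed.

Lemma minimizers_convex : convex_set (minimal_L1_dist p).
Proof.
move=> u v l /set_mem umin /set_mem vmin; apply: mem_set => q.
have l0 : 0 <= l%:num by [].
have l1 : l%:num <= 1 by [].
have : L1_dist p (conv l u v : plane R) <=
    l%:num * L1_dist p u + (1 - l%:num) * L1_dist p v.
  rewrite /L1_dist !mulr_sumr -big_split /=; apply: ler_sum => j _.
  have -> : y j - ((conv l u v : plane R).1 * x j + (conv l u v : plane R).2) =
    l%:num * (y j - (u.1 * x j + u.2)) +
    (1 - l%:num) * (y j - (v.1 * x j + v.2)).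
    by rewrite conv_planeE /=; ring.
  apply: le_trans (ler_normD _ _) _; rewrite !normrM (ger0_norm l0).
  by rewrite (ger0_norm (_ : 0 <= 1 - l%:num)) ?subr_ge0.
move/le_trans; apply.
have := umin q; have := vmin q; nra.
Qed.

(** Along [v + s d] the moving line reaches the point [j] at
    [residual v j / change d j].  The points with [change d j = 0] do not
    contribute, on either side. *)
Lemma L1_dist_line (v d : plane R) (s : R) :
  (forall j, change d j = 0 -> residual v j = 0) ->
  L1_dist p (v.1 + s * d.1, v.2 + s * d.2) =
  weighted_dist (fun j => `|change d j|) (fun j => residual v j / change d j) s.
Proof.
move=> dv; apply: eq_bigr => j _.
rewrite -[X in `|X|]/(residual _ j) residual_line -normrM.
have [d0|d0] := eqVneq (change d j) 0.
  by rewrite (dv j d0) d0 mulr0 subrr mul0r.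
by congr `| _ |; field.
Qed.

(** A minimizer lies between two minimizers on the line [v + s d] that meet a
    point which [v] misses; the conclusion is put in terms of a convex set [C]
    since this is how a convex hull is entered. *)
Lemma minimizer_between (v d : plane R) (C : set (plane R)) :
  convex_set C -> minimal_L1_dist p v ->
  (forall j, change d j = 0 <-> residual v j = 0) ->
  (exists j, change d j != 0) ->
  (forall (s : R) (j : 'I_m), let q := (v.1 + s * d.1, v.2 + s * d.2) in
     change d j != 0 -> residual q j = 0 -> minimal_L1_dist p q -> C q) ->
  C v.
Proof.
move=> Cconv vmin dv [j0 dj0] CH.
pose w j := `|change d j|; pose t j := residual v j / change d j.
have distE s : L1_dist p (v.1 + s * d.1, v.2 + s * d.2) = weighted_dist w t s.
  by apply: L1_dist_line => j /dv.
have dist0 : L1_dist p v = weighted_dist w t 0.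
  by rewrite -distE !mul0r !addr0; case: (v).
have [||||j [i [[]]]] := @weighted_median_neighbours _ _ w t.
- by move=> j; exact: normr_ge0.
- move=> j; rewrite normr_eq0 => dj; rewrite mulf_neq0 ?invr_neq0//.
  by apply/negP => /eqP /dv dj_eq0; rewrite dj_eq0 eqxx in dj.
- by exists j0; rewrite normr_eq0.
- by move=> s; rewrite -dist0 -distE; exact: vmin.
rewrite !normr_eq0 => dj di.
have Cpoint k : change d k != 0 ->
  weighted_dist w t (t k) = weighted_dist w t 0 ->
  C (v.1 + t k * d.1, v.2 + t k * d.2).
  move=> dk; rewrite -dist0 -distE => qv; apply: (CH _ k) => //.
    by rewrite residual_line divfK// subrr.
  by move=> q; rewrite qv.
move=> /andP[sj si] /(Cpoint j dj) + /(Cpoint i di).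
move: (t j) (t i) sj si => a b a0 b0 Ca Cb.
have ba : 0 < b - a by lra.
have l0 : 0 <= b / (b - a) by rewrite divr_ge0//; lra.
have l1 : b / (b - a) <= 1 by rewrite ler_pdivrMr//; lra.
have /set_mem := Cconv _ _ (Itv01 l0 l1) (mem_set Ca) (mem_set Cb).
rewrite conv_planeE /=; congr (C _); rewrite [RHS]surjective_pairing.
by congr pair; field; rewrite gt_eqF.
Qed.

Hypothesis x_inj : forall j k : 'I_m, j <> k -> x j <> x k.

Lemma minimizer_two_points (v : plane R) j k :
  j != k -> residual v j = 0 -> residual v k = 0 -> minimal_L1_dist p v ->
  minimal_lines p v.
Proof.
wlog kj : j k / (k < j)%N => [W|jk].
  move=> jk; case: (ltngtP k j) => [kj|jk'|/val_inj kj].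
  - exact: W kj jk.
  - by move=> rj rk; apply: W jk' _ rk rj; rewrite eq_sym.
  - by rewrite kj eqxx in jk.
move=> /subr0_eq yj /subr0_eq yk vmin; exists j, k; split=> //.
have xjk : x j - x k != 0 by rewrite subr_eq0; apply/eqP/x_inj/eqP.
rewrite [LHS]surjective_pairing /slope /intercept yj yk.
by congr pair; field.
Qed.

Lemma minimizer_one_point (v : plane R) (C : set (plane R)) i :
  (2 <= m)%N -> convex_set C -> minimal_lines p `<=` C ->
  residual v i = 0 -> minimal_L1_dist p v -> C v.
Proof.
move=> m2 Cconv EC ri vmin.
have [[j ji rj]|single] := pselect (exists2 j, j != i & residual v j = 0).
  by apply/EC/(minimizer_two_points ji rj ri).
(* Moving along d rotates the line about the point i. *)
pose d : plane R := (1, - x i).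
have changed j : j != i -> change d j != 0.
  move=> ji; rewrite /change /= mul1r subr_eq0.
  by apply/eqP/x_inj/eqP.
have changei : change d i = 0 by rewrite /change /= mul1r subrr.
apply: (@minimizer_between v d) => //.
- move=> j; have [->|ji] := eqVneq j i; first by rewrite ri changei.
  split=> [dj|rj]; first by have := changed j ji; rewrite dj eqxx.
  by exfalso; apply: single; exists j.
- pose j0 : 'I_m := Ordinal (ltnW m2); pose j1 : 'I_m := Ordinal m2.
  have [j0i|j0i] := eqVneq j0 i; last by exists j0; apply: changed.
  by exists j1; apply: changed; rewrite -j0i.
- move=> s j q dj rqj qmin; apply: EC; apply: (@minimizer_two_points q j i) => //.
    by apply/eqP => ji; rewrite ji changei eqxx in dj.
  by rewrite /q residual_line ri changei mulr0 subrr.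
Qed.

End Minimizers.

Theorem theorem4 (R : realType) (m : nat) (hm : (2 <= m)%N)
  (p : 'I_m -> R * R)
  (hp : forall j k : 'I_m, j <> k -> (p j).1 <> (p k).1) (a b : R) :
  minimal_L1_dist p (a, b) <-> convex_hull (minimal_lines p) (a, b).
Proof.
split=> [vmin C [Cconv EC]|]; last first.
  by apply; split; [exact: minimizers_convex|move=> v [j [k []]]].
have [[i ri]|noroot] := pselect (exists i, residual p (a, b) i = 0).
  exact: minimizer_one_point hp _ _ i hm Cconv EC ri vmin.
(* Moving along d translates the line vertically, which moves it at every
   abscissa. *)
pose d : plane R := (0, 1).
have changed j : change p d j = 1 by rewrite /change /= mul0r add0r.
apply: (@minimizer_between _ _ p (a, b) d) => //.
- move=> j; rewrite changed; split=> [/eqP|rj]; first by rewrite oner_eq0.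
  by exfalso; apply: noroot; exists j.
- by exists (Ordinal (ltnW hm)); rewrite changed oner_eq0.
- move=> s j q _ rj qmin.
  exact: minimizer_one_point hp _ _ j hm Cconv EC rj qmin.
Qed.
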